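(* Define integers $d_2, d_3, d_4, \dots$ by $d_2 = 2^2 = 4$ and $d_j = j^{d_{j-1}/(j-1)}$ for $j \ge 3$ (so $d_3 = 3^2$, $d_4 = 4^3$, $d_5 = 5^{16}$, \dots), and let $$\alpha = \prod_{j=2}^\infty \Big(1 - \frac{1}{d_j}\Big).$$ Then $\alpha$ is irrational and absolutely abnormal.
   Context: For an integer $b \ge 2$, a real number $\beta$ and a digit $0 \le a < b$, let $N(\beta; b, a, x)$ be the number of $n$ with $1 \le n \le x$ such that the $n$th digit after the point in the base-$b$ expansion of $\beta$ is $a$, and let $\delta(\beta; b, a) = \lim_{x\to\infty} x^{-1} N(\beta;b,a,x)$ when this limit exists. $\beta$ is simply normal to base $b$ if $\delta(\beta;b,a)$ exists and equals $1/b$ for every $0 \le a < b$ (a $b$-adic fraction $a/b^n$ is not simply normal to base $b$ with respect to either of its two expansions). $\beta$ is normal to base $b$ if it is simply normal to each of the bases $b, b^2, b^3, \dots$. $\beta$ is abnormal to base $b$ if it is not normal to base $b$, and absolutely abnormal if it is abnormal to every base $b \ge 2$. *)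

(* Defs.v *)
From mathcomp Require Import all_boot all_order all_algebra.
From mathcomp Require Import all_classical all_reals all_analysis.
From mathcomp Require Import ring lra zify.

Set Implicit Arguments.
Unset Strict Implicit.
Unset Printing Implicit Defensive.

Import Order.TTheory GRing.Theory Num.Theory.
Import numFieldNormedType.Exports.

Local Open Scope classical_set_scope.
Local Open Scope ring_scope.

(** The sequence d_2 = 4, d_j = j ^ (d_(j-1) / (j-1)) for j >= 3. The values at
    j = 0 and j = 1 are junk and are never used; [dvdn_d] shows that the
    Euclidean quotient in the exponent is exact. *)
Fixpoint d (j : nat) : nat :=
  match j with
  | 0 => 0
  | j1.+1 => if j1 == 1%N then (2 ^ 2)%N else (j1.+1 ^ (d j1 %/ j1))%N
  end.
Arguments d : simpl never.

Lemma d2 : d 2 = 4.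
Proof. by []. Qed.

Lemma d_rec (j : nat) : (3 <= j)%N -> d j = (j ^ (d j.-1 %/ j.-1))%N.
Proof. by case: j => [|[|[|j]]]. Qed.

Lemma d_gt0 (j : nat) : (2 <= j)%N -> (0 < d j)%N.
Proof.
case: j => [|[|[|j]]] // _.
by rewrite d_rec // expn_gt0.
Qed.

Lemma dvdn_d (j : nat) : (2 <= j)%N -> (j %| d j)%N.
Proof.
elim: j => [|[|[|j]] IHj] // _.
rewrite d_rec //= dvdn_exp // divn_gt0 //.
by rewrite dvdn_leq ?d_gt0 ?IHj.
Qed.

Lemma d_ge2 (j : nat) : (2 <= j)%N -> (2 <= d j)%N.
Proof. by move=> j2; rewrite (leq_trans j2)// dvdn_leq ?d_gt0 ?dvdn_d. Qed.

Definition alpha_partial (R : realType) (n : nat) : R :=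
  \prod_(2 <= j < n.+1) (1 - ((d j)%:R)^-1).

Definition alpha (R : realType) : R := limn (@alpha_partial R).

Lemma is_cvg_alpha_partial (R : realType) : cvgn (@alpha_partial R).
Proof.
have H j : (2 <= j)%N -> 0 <= (1 - ((d j)%:R)^-1 : R) <= 1.
  move=> /d_ge2 dj; rewrite subr_ge0 gerBl invr_ge0 ler0n andbT.
  by rewrite invf_le1 ?ltr0n ?ler1n; lia.
have P0 n : 0 <= alpha_partial R n.
  rewrite /alpha_partial big_nat_cond; apply: prodr_ge0 => j.
  by rewrite andbT => /andP[j2 _]; case/andP: (H j j2).
apply: nonincreasing_is_cvgn.
  apply/nonincreasing_seqP => n; rewrite /alpha_partial.
  have [n0|n1] := ltnP n 1; first by rewrite !big_geq//; lia.
  rewrite big_nat_recr //= ler_piMr //; exact: P0.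
by exists 0 => _ [n _ <-].
Qed.

(** The [n]th digit after the point ([n >= 1]) of the base-[b] expansion of
    [|beta|]; a [b]-adic fraction gets its terminating expansion. *)
Definition digit (R : realType) (beta : R) (b n : nat) : nat :=
  (Num.truncn (`|beta| * b%:R ^+ n) %% b)%N.

Lemma digit_lt (R : realType) (beta : R) (b n : nat) :
  (0 < b)%N -> (digit beta b n < b)%N.
Proof. exact: ltn_pmod. Qed.

Lemma digit_partial_sum (R : realType) (beta : R) (b n : nat) : (0 < b)%N ->
  (Num.truncn `|beta|)%:R + \sum_(1 <= k < n.+1) (digit beta b k)%:R / b%:R ^+ k
  = (Num.truncn (`|beta| * b%:R ^+ n))%:R / b%:R ^+ n :> R.
Proof.
move=> b0; have bR : 0 < b%:R :> R by rewrite ltr0n.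
elim: n => [|n IHn]; first by rewrite big_geq // addr0 expr0 divr1 mulr1.
rewrite big_nat_recr //= addrA IHn /digit.
set y := `|beta| * b%:R ^+ n.
have y0 : 0 <= y by rewrite mulr_ge0 // exprn_ge0 // ltW.
rewrite exprSr mulrA -/y.
have -> : Num.truncn y = (Num.truncn (y * b%:R) %/ b)%N.
  apply: truncn_def; have /truncn_itv/andP[h1 h2] : 0 <= y * b%:R.
    by rewrite mulr_ge0 // ltW.
  apply/andP; split.
    rewrite -(ler_pM2r bR) -natrM (le_trans _ h1) // ler_nat.
    exact: leq_divM.
  rewrite -(ltr_pM2r bR) -natrM (lt_le_trans h2) // ler_nat.
  exact: ltn_ceil.
set m := Num.truncn _.
rewrite [in RHS](divn_eq m b) natrD natrM; field.
by rewrite expf_neq0 ?lt0r_neq0.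
Qed.

(** For a real [x >= 0], the indices [1 <= n <= x] are [1 .. truncn x]. *)
Definition digit_count (R : realType) (beta : R) (b a : nat) (x : R) : nat :=
  count (fun n => digit beta b n == a) (iota 1 (Num.truncn x)).

Definition has_digit_density (R : realType) (beta : R) (b a : nat) (l : R) :=
  x^-1 * (digit_count beta b a x)%:R @[x --> +oo] --> l.

Definition simply_normal (R : realType) (beta : R) (b : nat) :=
  forall a : nat, (a < b)%N -> has_digit_density beta b a (b%:R^-1).

Definition normal_to_base (R : realType) (beta : R) (b : nat) :=
  forall k : nat, (1 <= k)%N -> simply_normal beta (b ^ k)%N.

Definition abnormal_to_base (R : realType) (beta : R) (b : nat) :=
  ~ normal_to_base beta b.

Definition absolutely_abnormal (R : realType) (beta : R) :=
  forall b : nat, (2 <= b)%N -> abnormal_to_base beta b.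

(* Main.v *)
Require Import Defs.
From mathcomp Require Import all_boot all_order all_algebra.
From mathcomp Require Import all_classical all_reals all_analysis.
From mathcomp Require Import ring lra zify.

(** Since [j = 1] modulo [j-1], the exponent in [d_j] makes [d_(j-1)] divide
    [d_j - 1]. Hence the denominators in the partial products telescope: the
    [k]th partial product [alpha_k] is an integer divided by [d_k], a power of
    [k]. On the other hand [0 < alpha_k - alpha <= 2 / d_(k+1)], which is tiny
    compared with [1 / d_k]; this already excludes rationality. Taking
    [k = b ^ m], [alpha] lies just below the [b]-adic fraction [alpha_k], so
    its base-[b] expansion contains a run of digits [b-1] which starts at a
    position negligible with respect to the position where it ends. Along these
    end positions the frequency of the digit [0] stays away from [1/b]. *)

Set Implicit Arguments.
Unset Strict Implicit.
Unset Printing Implicit Defensive.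

Import Order.TTheory GRing.Theory Num.Theory.
Import numFieldNormedType.Exports.

Local Open Scope classical_set_scope.
Local Open Scope ring_scope.

(** * The integers [d_j] *)

(** The exponent of [j] in [d j]. The case [j = 2] is separate because the quotient would involve
    the junk value [d 1]. *)
Definition dexp (j : nat) : nat := if (j == 2)%N then 2 else (d j.-1 %/ j.-1)%N.

Lemma d_dexp (j : nat) : (2 <= j)%N -> d j = (j ^ dexp j)%N.
Proof.
move=> j2; rewrite /dexp; case: eqP => [->//|j2N].
by rewrite d_rec//; lia.
Qed.

Lemma dexpS (j : nat) : (2 <= j)%N -> dexp j.+1 = (j ^ (dexp j).-1)%N.
Proof.
move=> j2; have e0 : (0 < dexp j)%N.
  rewrite lt0n; apply/eqP => e0.
  by have := d_ge2 j2; rewrite d_dexp// e0.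
rewrite {1}/dexp ifF; last by apply/eqP; lia.
by rewrite /= d_dexp// -[in LHS](prednK e0) expnSr mulnK//; lia.
Qed.

Lemma dexp_ge2 (j : nat) : (2 <= j)%N -> (2 <= dexp j)%N.
Proof.
elim: j => // j IHj; rewrite leq_eqVlt => /predU1P[<-//|].
rewrite ltnS => j2; rewrite dexpS// (leq_trans j2)// -{1}(expn1 j) leq_pexp2l; have := IHj j2; lia.
Qed.

Lemma ltn_dexp (j : nat) : (3 <= j)%N -> (dexp j < dexp j.+1)%N.
Proof.
move=> j3; have := dexp_ge2 (ltnW j3); rewrite dexpS; last lia.
case: (dexp j) => [|[|e]]// _ /=.
have : (3 ^ e.+1 <= j ^ e.+1)%N by rewrite leq_exp2r.
apply: leq_trans; elim: e => // e IHe; rewrite expnS; lia.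
Qed.

Lemma dexp_ge3 (j : nat) : (4 <= j)%N -> (3 <= dexp j)%N.
Proof.
case: j => // j j4; have := @ltn_dexp j j4; have := @dexp_ge2 j; lia.
Qed.

(** With [e = dexp j], the right side is [j ^ (e - 1)], and [e <= j ^ (e - 2)] as [e >= 3]. This
    growth makes the start of a run of digits negligible against its end. *)
Lemma muln_dexp_le (j : nat) : (4 <= j)%N -> (j * dexp j <= dexp j.+1)%N.
Proof.
move=> j4; have := dexp_ge3 j4; rewrite dexpS; last lia.
case: (dexp j) => [|[|[|e]]]// _ /=; rewrite expnS leq_pmul2l; last lia.
have : (4 ^ e.+1 <= j ^ e.+1)%N by rewrite leq_exp2r.
apply: leq_trans; elim: e => // e IHe; rewrite expnS; lia.
Qed.

(** The exponent grows by at least one from [j] to [j.+1], which yields the factor [j.+1]. That this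
    factor is unbounded gives irrationality. *)
Lemma leq_muln_d (j : nat) : (3 <= j)%N -> (j.+1 * d j <= d j.+1)%N.
Proof.
move=> j3; rewrite !d_dexp; [|lia|lia].
have /(@leq_pexp2l j.+1) := ltn_dexp j3; move/(_ isT); apply: leq_trans.
by rewrite expnS leq_pmul2l// leq_exp2r//; have := @dexp_ge2 j; lia.
Qed.

Lemma double_d_le (j : nat) : (2 <= j)%N -> (2 * d j <= d j.+1)%N.
Proof.
rewrite leq_eqVlt => /predU1P[<-//|j3].
by apply: leq_trans (leq_muln_d j3); rewrite leq_pmul2r ?d_gt0//; lia.
Qed.

(** Induction on [i]: with [x = k.+1 ^ (k ^ i)], factor [x ^ k - 1] as [x - 1] times a sum of [k]
    powers of [x]. Each power is 1 modulo [k], so the sum is divisible by [k]. *)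
Lemma dvdn_expSn_predn (k i : nat) : (k ^ i.+1 %| (k.+1 ^ (k ^ i)).-1)%N.
Proof.
elim: i => [|i IHi]; first by rewrite expn0 expn1.
rewrite [X in (_ ^ X).-1]expnSr expnM predn_exp expnSr dvdn_mul//.
set x := (k.+1 ^ (k ^ i))%N.
have x1 : (x = 1 %[mod k])%N by rewrite /x -modnXm -addn1 modnDl modnXm exp1n.
rewrite /dvdn -modn_summ.
under eq_bigr do rewrite -modnXm x1 modnXm exp1n.
by rewrite modn_summ sum_nat_const card_ord muln1 modnn.
Qed.

Lemma d_dvdn_predn (j : nat) : (2 <= j)%N -> (d j %| (d j.+1).-1)%N.
Proof.
move=> j2; have := dexp_ge2 j2; rewrite (d_dexp j2) d_dexp; last lia.
by rewrite dexpS//; case: (dexp j) => [|e]//= _; exact: dvdn_expSn_predn.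
Qed.

(** * Partial products *)

Section alpha.
Variable R : realType.

Let dR_gt0 (j : nat) : (2 <= j)%N -> 0 < (d j)%:R :> R.
Proof. by move=> j2; rewrite ltr0n d_gt0. Qed.

Lemma alpha_partialS (k : nat) : (1 <= k)%N ->
  alpha_partial R k.+1 = alpha_partial R k * (1 - (d k.+1)%:R^-1).
Proof. by move=> k1; rewrite /alpha_partial big_nat_recr. Qed.

Lemma alpha_partial_itv (k : nat) : (1 <= k)%N -> 0 < alpha_partial R k <= 1.
Proof.
elim: k => // -[_ _|k IHk _]; first by rewrite /alpha_partial big_geq// ltr01/=.
rewrite alpha_partialS//; have /andP[a0 a1] := IHk isT.
have d1 : (d k.+2)%:R^-1 < 1 :> R.
  by rewrite invf_lt1 ?dR_gt0// ltr1n; exact: d_ge2.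
have d0 : 0 < (d k.+2)%:R^-1 :> R by rewrite invr_gt0 dR_gt0.
by rewrite mulr_gt0 ?subr_gt0//= mulr_ile1// ?ltW// ?subr_gt0//; lra.
Qed.

Lemma alpha_partial_dfrac (k : nat) : (2 <= k)%N ->
  exists A : nat, alpha_partial R k = A%:R / (d k)%:R.
Proof.
elim: k => // k IHk; rewrite leq_eqVlt ltnS => /predU1P[<-|k2].
  by exists 3%N; rewrite /alpha_partial big_nat1 d2; lra.
have [A AE] := IHk k2; have /dvdnP[q qE] := d_dvdn_predn k2.
exists (A * q)%N; rewrite alpha_partialS ?AE; last lia.
have dk0 := dR_gt0 k2; have dk1 := dR_gt0 (leqW k2).
(* The new factor is [q * d k / d k.+1], whose numerator cancels the old denominator. *)
have -> : (d k.+1)%:R = q%:R * (d k)%:R + 1 :> R.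
  by rewrite -natrM -qE natr1 prednK// d_gt0// leqW.
rewrite natrM; field; rewrite lt0r_neq0//=.
by rewrite lt0r_neq0// ltr_wpDl// mulr_ge0 ?ler0n.
Qed.

Lemma alpha_lt_partial (k : nat) : (1 <= k)%N -> alpha R < alpha_partial R k.
Proof.
move=> k1; have step n : alpha_partial R (1 + n).+1 <= alpha_partial R (1 + n).
  have /andP[a0 _] := @alpha_partial_itv (1 + n) isT.
  by rewrite alpha_partialS// ler_piMr// ?ltW// gtrBl invr_gt0 dR_gt0.
have le n m : (1 <= n)%N -> (n <= m)%N -> alpha_partial R m <= alpha_partial R n.
  move=> n1 /subnK <-; elim: (m - n)%N => // p; rewrite addSn; apply: le_trans.
  by have := step (p + n).-1; rewrite add1n prednK//; lia.
(* The limit only preserves weak inequalities; strictness comes from one further factor. *)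
apply: (@le_lt_trans _ _ (alpha_partial R k.+1)).
  apply: limr_le; first exact: is_cvg_alpha_partial.
  by near=> n; apply: le => //; near: n; exact: nbhs_infty_ge.
have /andP[a0 _] := alpha_partial_itv k1.
by rewrite alpha_partialS// gtr_pMr// gtrBl invr_gt0 dR_gt0.
Unshelve. all: by end_near. Qed.

(** The sequence [alpha_n - 2 / d_(n+1)] is nondecreasing. *)
Lemma alpha_ge_partial (k : nat) : (1 <= k)%N ->
  alpha_partial R k - 2 / (d k.+1)%:R <= alpha R.
Proof.
move=> k1; apply: limr_ge; first exact: is_cvg_alpha_partial.
near=> n; have /subnK <- : (k <= n)%N by near: n; exact: nbhs_infty_ge.
apply: (@le_trans _ _
  (alpha_partial R (n - k + k) - 2 / (d (n - k + k).+1)%:R)); last first.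
  by rewrite gerBl divr_ge0.
elim: (n - k)%N => // p; rewrite addSn; move/le_trans; apply.
set j := (p + k)%N; have j1 : (1 <= j)%N by lia.
rewrite alpha_partialS//; have /andP[a0 a1] := alpha_partial_itv j1.
have d0 := @dR_gt0 j.+1 j1.
(* The next partial product drops by at most [1 / d j.+1]; the new error term fits in the other half
   of [2 / d j.+1]. *)
have : 2 / (d j.+2)%:R <= (d j.+1)%:R^-1 :> R.
  rewrite ler_pdivrMr ?dR_gt0// mulrC ler_pdivlMr// -natrM ler_nat.
  exact: double_d_le.
have : 0 < (d j.+1)%:R^-1 :> R by rewrite invr_gt0.
nra.
Unshelve. all: by end_near. Qed.

Lemma alpha_ge0 : 0 <= alpha R.
Proof.
apply: limr_ge; first exact: is_cvg_alpha_partial.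
near=> n; have /alpha_partial_itv/andP[/ltW//] : (1 <= n)%N.
by near: n; exact: nbhs_infty_ge.
Unshelve. all: by end_near. Qed.

(** If [alpha] had denominator [n], then [n * d k] times the gap between the [k]th partial product
    and [alpha] would be an integer strictly between 0 and 1. *)
Lemma alpha_irrational : @irrational R (alpha R).
Proof.
move=> [q _ qE]; pose n := `|denq q|%N.
have n0 : (0 < n)%N by rewrite absz_gt0 denq_neq0.
have nE : alpha R * n%:R = (numq q)%:~R.
  rewrite -qE -[n%:R]/(n%:Z%:~R) /n absz_denq.
  by rewrite /ratr divfK// intr_eq0 denq_neq0.
(* Chosen so that [2 * n < k.+1], hence [2 * n * d k < d k.+1]. *)
pose k := (2 * n).+2; have k2 : (2 <= k)%N by [].
have [A AE] := @alpha_partial_dfrac k k2.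
have dk := dR_gt0 k2; have dk1 := @dR_gt0 k.+1 isT.
have lt := @alpha_lt_partial k isT; have ge := @alpha_ge_partial k isT.
pose z : int := A%:Z * n%:Z - numq q * (d k)%:Z.
have zE : z%:~R = (alpha_partial R k - alpha R) * ((d k)%:R * n%:R) :> R.
  rewrite /z rmorphB/= !rmorphM/= -!pmulrn -nE AE; field.
  by rewrite lt0r_neq0.
have nR : 0 < n%:R :> R by rewrite ltr0n.
have z0 : 0 < z%:~R :> R by rewrite zE mulr_gt0 ?subr_gt0// mulr_gt0.
have z1 : z%:~R < 1 :> R.
  rewrite zE; apply: (@le_lt_trans _ _ (2 / (d k.+1)%:R * ((d k)%:R * n%:R))).
    by rewrite ler_pM2r ?mulr_gt0//; lra.
  rewrite mulrAC ltr_pdivrMr// mul1r -!natrM ltr_nat.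
  have k3 : (3 <= k)%N by lia.
  apply: leq_trans (leq_muln_d k3).
  by rewrite mulnCA mulnC ltn_pmul2r ?d_gt0// /k; lia.
by move: z0 z1; rewrite ltr0z ltrz1; lia.
Qed.

(** * Digits *)

(** Scaling by [b ^ n] turns the fraction into a multiple [M] of [b], and [e] into a number in the
    interval from 0 (excluded) to 1 (included). The integer part is thus [M - 1], which is [b - 1]
    modulo [b]. *)
Lemma digit_dfrac_sub (b p n A : nat) (e : R) : (2 <= b)%N -> (p < n)%N ->
  0 <= A%:R / b%:R ^+ p - e -> 0 < e -> e * b%:R ^+ n <= 1 ->
  digit (A%:R / b%:R ^+ p - e) b n = b.-1.
Proof.
move=> b2 pn x0 e0 e1; have bR : 0 < b%:R :> R by rewrite ltr0n; lia.
rewrite /digit ger0_norm//; have bn0 := exprn_gt0 n bR.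
pose M := (A * b ^ (n - p))%N.
have ME : (A%:R / b%:R ^+ p - e) * b%:R ^+ n = M%:R - e * b%:R ^+ n.
  rewrite mulrBl; congr (_ - _).
  rewrite /M natrM natrX -[in LHS](subnK (ltnW pn)) exprD.
  by field; rewrite expf_neq0// lt0r_neq0.
have M0 : (0 < M)%N.
  have : 0 <= M%:R - e * b%:R ^+ n by rewrite -ME mulr_ge0// ltW.
  have : 0 < e * b%:R ^+ n by rewrite mulr_gt0.
  by move=> h1 h2; rewrite -(ltr0n R); lra.
have -> : Num.truncn ((A%:R / b%:R ^+ p - e) * b%:R ^+ n) = M.-1.
  apply: truncn_def; rewrite ME prednK//.
  have -> : M.-1%:R = M%:R - 1 :> R by rewrite -[in RHS](prednK M0) -natr1 addrK.
  have : 0 < e * b%:R ^+ n by rewrite mulr_gt0.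
  by move=> h; apply/andP; split; lra.
have /dvdnP[q qE] : (b %| M)%N by rewrite dvdn_mull// dvdn_exp//; lia.
have q0 : (0 < q)%N by move: M0; rewrite qE; case: q {qE}.
have -> : M.-1 = (q.-1 * b + b.-1)%N.
  by rewrite qE -[in LHS](prednK q0) mulSn; lia.
by rewrite modnMDl modn_small//; lia.
Qed.

Lemma digit_alpha (b m n : nat) : (2 <= b)%N -> (1 <= m)%N ->
  (m * dexp (b ^ m) < n)%N -> (n < m * dexp (b ^ m).+1)%N ->
  digit (alpha R) b n = b.-1.
Proof.
move=> b2 m1; set k := (b ^ m)%N => n1 n2.
have k2 : (2 <= k)%N by rewrite (leq_trans b2)// -{1}(expn1 b) leq_pexp2l//; lia.
have k1 := ltnW k2; have dk1 := @dR_gt0 k.+1 (leqW k2).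
have [A AE] := alpha_partial_dfrac k2.
have dE : (d k)%:R = b%:R ^+ (m * dexp k) :> R.
  by rewrite d_dexp// -natrX expnM.
have lt := alpha_lt_partial k1; have ge := alpha_ge_partial k1.
have aE : alpha R = A%:R / b%:R ^+ (m * dexp k) - (alpha_partial R k - alpha R).
  by rewrite -dE -AE; ring.
rewrite aE digit_dfrac_sub// -?aE ?alpha_ge0 ?subr_gt0//.
have bR : 0 < b%:R :> R by rewrite ltr0n; lia.
apply: (@le_trans _ _ (2 / (d k.+1)%:R * b%:R ^+ n)).
  by rewrite ler_pM2r ?exprn_gt0//; lra.
rewrite mulrAC ler_pdivrMr// mul1r -natrX -natrM ler_nat.
(* The 2 in the error bound costs one factor [b], hence one position at the end of the run. *)
apply: (@leq_trans (b ^ n.+1)); first by rewrite expnS leq_pmul2r// expn_gt0; lia.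
apply: (@leq_trans (b ^ (m * dexp k.+1))); first by rewrite leq_pexp2l//; lia.
rewrite expnM -/k d_dexp ?leqW// leq_exp2r//.
by have := @dexp_ge2 k.+1; lia.
Qed.

Lemma digit_count_alpha (b m : nat) : (2 <= b)%N -> (2 <= m)%N ->
  (digit_count (alpha R) b 0 (m * dexp (b ^ m).+1).-1%:R <= m * dexp (b ^ m))%N.
Proof.
move=> b2 m2; rewrite /digit_count natrK.
set p := (m * dexp (b ^ m))%N; set N := (m * _).-1.
(* Cutting at the minimum avoids comparing [p] with [N]. Past [p] all digits are [b.-1], which is
   nonzero, so only the first piece can contain zeros. *)
have -> : iota 1 N = iota 1 (minn p N) ++ iota (1 + minn p N) (N - minn p N).
  by rewrite -iotaD subnKC// geq_minr.
rewrite count_cat; set c1 := count _ _; set c2 := count _ _.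
have -> : c2 = 0%N.
  apply/eqP; rewrite eqn0Ngt -has_count; apply/hasPn => n.
  rewrite mem_iota => /andP[n1 n2]; rewrite (@digit_alpha b m)//.
  - by rewrite -lt0n; lia.
  - lia.
  - by rewrite -/p; lia.
  - by move: n1 n2; rewrite /N; lia.
rewrite addn0 (leq_trans (count_size _ _))// size_iota geq_minl//.
Qed.

Lemma alpha_not_simply_normal (b : nat) : (2 <= b)%N -> ~ simply_normal (alpha R) b.
Proof.
move=> b2 /(_ 0%N (ltnW b2)) cv.
have bR : 0 < b%:R :> R by rewrite ltr0n; lia.
have h0 : 0 < (2 * b%:R)^-1 :> R by rewrite invr_gt0 mulr_gt0.
have [x0 [_ Hx]] := cvgr_dist_lt _ _ cv _ h0.
(* The 3 ensures [4 * b <= b ^ m]; the other bound puts the end of the run beyond [x0]. *)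
pose m := maxn 3 (Num.truncn x0).+1.
have m3 : (3 <= m)%N by rewrite leq_maxl.
pose k := (b ^ m)%N.
have kb : (4 * b <= k)%N.
  apply: (@leq_trans (b ^ 3)); last by rewrite leq_pexp2l//; lia.
  by rewrite expnSr leq_mul// (@leq_exp2r 2 b 2).
have k4 : (4 <= k)%N by lia.
have ek := dexp_ge2 (ltnW (ltnW k4)).
pose N := (m * dexp k.+1).-1.
(* Growth gives the factor [4 * b]; half of it absorbs the predecessor in [N]. *)
have kN : (2 * b * (m * dexp k) <= N)%N.
  have : (4 * b * (m * dexp k) <= m * dexp k.+1)%N.
    rewrite mulnCA leq_pmul2l ?(ltnW (ltnW m3))//.
    by rewrite (leq_trans (leq_mul kb (leqnn _)))// muln_dexp_le.
  have : (0 < m * dexp k)%N by rewrite muln_gt0 (ltnW (ltnW m3)) ltnW.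
  by rewrite /N; move: (m * dexp k)%N (m * dexp k.+1)%N => X Y; nia.
have mN : (m <= N)%N.
  apply: leq_trans kN; rewrite mulnCA -[X in (X <= _)%N]muln1.
  rewrite leq_pmul2l; last exact: ltnW (ltnW m3).
  by rewrite !muln_gt0/= (ltnW b2) ltnW.
have N0 : 0 < N%:R :> R by rewrite ltr0n; lia.
have /Hx : x0 < N%:R.
  apply: (lt_le_trans (truncnS_gt x0)); rewrite ler_nat (leq_trans _ mN)//.
  by rewrite leq_maxr.
have := @digit_count_alpha b m b2 (ltnW m3); rewrite -/k -/N.
set c := digit_count _ _ _ _ => cle /=.
have cN : N%:R^-1 * c%:R <= (2 * b%:R)^-1 :> R.
  rewrite mulrC ler_pdivrMr// mulrC ler_pdivlMr ?mulr_gt0//.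
  by rewrite -!natrM ler_nat; nia.
(* The frequency of 0 up to [N] is at most half of [1 / b], so it misses the limit by at least the
   chosen tolerance. *)
have -> : b%:R^-1 = 2 * (2 * b%:R)^-1 :> R by field; rewrite lt0r_neq0.
by rewrite real_ltNge ?num_real//= => /negP; apply; rewrite ler_normr; lra.
Qed.

End alpha.

Theorem mainTheorem1 (R : realType) :
  @irrational R (alpha R) /\ absolutely_abnormal (alpha R).
Proof.
split=> [|b b2 /(_ 1%N isT)]; first exact: alpha_irrational.
by rewrite expn1; exact: alpha_not_simply_normal.
Qed.
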